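(* Let $\widehat{A}$ be an $n\times n$ symmetric dual matrix (i.e. $\widehat{A}^{T}=\widehat{A}$) whose dual index is one. Then the dual group generalized inverse $\widehat{A}^{\#}$, the dual Moore–Penrose generalized inverse $\widehat{A}^{+}$ and the dual core generalized inverse $\widehat{A}^{\mathrm{c}}$ of $\widehat{A}$ coincide: $$\widehat{A}^{\#}=\widehat{A}^{+}=\widehat{A}^{\mathrm{c}}$$ (in particular all three exist).
   Context: Dual numbers are $a+\varepsilon a'$ with $a,a'\in\mathbb{R}$ and $\varepsilon\neq 0$, $\varepsilon^2=0$ (i.e. the ring $\mathbb{R}[\varepsilon]/(\varepsilon^2)$). A dual matrix is a matrix over dual numbers, written $\widehat{A}=A+\varepsilon B$ with $A,B$ real; its transpose is $\widehat{A}^{T}=A^{T}+\varepsilon B^{T}$. The range $\mathcal{R}(\widehat{A})$ of an $n\times n$ dual matrix is $\{\widehat{A}\widehat{x}: \widehat{x}$ a dual column vector of length $n\}$; the dual index of $\widehat{A}$ is said to be equal to one if $\mathcal{R}(\widehat{A}^2)=\mathcal{R}(\widehat{A})$. Each inverse below is unique when it exists: $\widehat{A}^{\#}$ is the $\widehat{G}$ with $\widehat{A}\widehat{G}\widehat{A}=\widehat{A}$, $\widehat{G}\widehat{A}\widehat{G}=\widehat{G}$, $\widehat{A}\widehat{G}=\widehat{G}\widehat{A}$; $\widehat{A}^{+}$ is the $\widehat{X}$ with $\widehat{A}\widehat{X}\widehat{A}=\widehat{A}$, $\widehat{X}\widehat{A}\widehat{X}=\widehat{X}$, $(\widehat{A}\widehat{X})^{T}=\widehat{A}\widehat{X}$,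 $(\widehat{X}\widehat{A})^{T}=\widehat{X}\widehat{A}$; $\widehat{A}^{\mathrm{c}}$ is the $\widehat{G}$ with $\widehat{A}\widehat{G}\widehat{A}=\widehat{A}$, $\widehat{A}\widehat{G}^2=\widehat{G}$, $(\widehat{A}\widehat{G})^{T}=\widehat{A}\widehat{G}$. *)

(* Defs.v *)
From mathcomp Require Import all_boot all_order all_algebra.
From mathcomp Require Import classical_sets reals.

Set Implicit Arguments.
Unset Strict Implicit.
Unset Printing Implicit Defensive.

Import GRing.Theory.
Local Open Scope ring_scope.
Local Open Scope classical_set_scope.

(* R[X]/(X^2); 'X^2 is monic of size > 1, so this is a genuine quotient by
   X^2 and not the degenerate default of {poly %/ _}: see dual_eps_sqr,
   dual_eps_neq0 and dualP below. *)
Notation dual R := {poly %/ ('X^2 : {poly R})}.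

Definition dual_eps (R : realType) : dual R := 'qX.

Definition dual_re (R : realType) (a : R) : dual R := qpolyC 'X^2 a.

Lemma dual_epsE (R : realType) : dual_eps R = 'X :> {poly R}.
Proof. by apply: qpolyXE; rewrite ?size_polyXn ?monicXn. Qed.

Lemma dual_eps_sqr (R : realType) : dual_eps R ^+ 2 = 0.
Proof.
apply/val_inj; rewrite [LHS]poly_of_qpolyX dual_epsE.
rewrite [X in Pdiv.CommonRing.rmodp _ X]mk_monic_Xn.
by rewrite Pdiv.RingMonic.rmodpp ?monicXn.
Qed.

Lemma dual_eps_neq0 (R : realType) : dual_eps R != 0.
Proof. by rewrite -val_eqE [X in X != _]dual_epsE polyX_eq0. Qed.

Lemma dualP (R : realType) (x : dual R) :
  exists! p : R * R, x = dual_re p.1 + dual_eps R * dual_re p.2.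
Proof.
have E (a b : R) :
    dual_re a + dual_eps R * dual_re b = a%:P + 'X * b%:P :> {poly R}.
  rewrite poly_of_qpolyD poly_of_qpolyM dual_epsE !qpolyCE mk_monic_Xn.
  rewrite Pdiv.CommonRing.rmodp_small // size_polyXn mulrC mul_polyC.
  by rewrite (leq_ltn_trans (size_scale_leq _ _)) // size_polyX.
have C (a b : R) i : (a%:P + 'X * b%:P : {poly R})`_i =
    (if i == 0%N then a else if i == 1%N then b else 0).
  by rewrite coefD coefXM !coefC; case: i => [|[|i]] /=; rewrite ?addr0 ?add0r.
exists ((x : {poly R})`_0, (x : {poly R})`_1).
split=> [|[a b] ->]; last by rewrite E !C.
apply/val_inj; rewrite [RHS]E; apply/polyP => -[|[|i]]; rewrite C //=.
apply: nth_default; apply: leq_trans (size_npoly x) _.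
by rewrite mk_monic_Xn size_polyXn.
Qed.

Section DualInverses.
Variables (R : realType) (n : nat).
Implicit Types A G X : 'M[dual R]_n.

Definition dual_range A : set 'cV[dual R]_n := range (fun x => A *m x).

Definition dual_index_one A : Prop := dual_range (A *m A) = dual_range A.

Definition is_dual_group_inverse A G : Prop :=
  [/\ A *m G *m A = A, G *m A *m G = G & A *m G = G *m A].

Definition is_dual_MP_inverse A X : Prop :=
  [/\ A *m X *m A = A, X *m A *m X = X,
      (A *m X)^T = A *m X & (X *m A)^T = X *m A].

Definition is_dual_core_inverse A G : Prop :=
  [/\ A *m G *m A = A, A *m (G *m G) = G & (A *m G)^T = A *m G].

End DualInverses.

(* Main.v *)
(* If the range of A^2 contains that of A, then A = A^2 X, and transposing
   gives A = X^T A^2 by symmetry of A. Hence X^T A = X^T A^2 X = A X, and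
   G = X^T A X satisfies A G = A X = X^T A = G A. This G is symmetric and
   commutes with A, so it satisfies all three systems of equations. *)
Require Import Defs.
From mathcomp Require Import all_boot all_order all_algebra.
From mathcomp Require Import boolp classical_sets reals.
Local Open Scope ring_scope.

(** Each column of [A] is the image of a basis vector, hence lies in the range of [B]; chosen
    preimages form the columns of [X]. *)
Lemma dual_range_subset_factor (R : realType) (n : nat) (A B : 'M[dual R]_n) :
  (dual_range A `<=` dual_range B)%classic -> exists X, A = B *m X.
Proof.
move=> sAB.
have /choice[x xE] (j : 'I_n) : exists x : 'cV_n, B *m x = col j A.
  have [|x _ xE] := sAB (col j A); first by exists (delta_mx j 0); rewrite ?colE.
  by exists x.
exists (\matrix_(i, j) x j i 0); apply/matrixP => i j.
have /matrixP/(_ i 0) := xE j; rewrite !mxE => <-.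
by apply: eq_bigr => k _; rewrite mxE.
Qed.

Lemma symmetric_factor_group_inverse (R : comPzRingType) (n : nat)
    (A X : 'M[R]_n) (G := X^T *m A *m X) :
    A^T = A -> A = A *m A *m X ->
  [/\ G^T = G, A *m G = G *m A, A *m G *m A = A & G *m A *m G = G].
Proof.
move=> A_sym AX.
have XA : X^T *m A *m A = A by rewrite -{3}A_sym {3}AX !trmx_mul A_sym mulmxA.
have XAX : X^T *m A = A *m X by rewrite {1}AX !mulmxA XA.
have AG : A *m G = A *m X.
  by rewrite /G XAX !mulmxA -AX.
(* Trading the inner [A X] for [X^T A] gives G A = X^T (X^T A A). *)
have GA : G *m A = X^T *m A.
  by rewrite /G -(mulmxA X^T) -XAX -!mulmxA (mulmxA X^T A A) XA.
split.
- by rewrite /G !trmx_mul trmxK A_sym mulmxA.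
- by rewrite AG GA.
- by rewrite AG -XAX XA.
- by rewrite GA -mulmxA AG mulmxA.
Qed.

(** A symmetric idempotent is determined by its range: A G = (A H A G)^T = A G A H = A H. *)
Lemma symmetric_projector_eq (R : comPzRingType) (n : nat)
    (A G H : 'M[R]_n) :
    A *m G *m A = A -> A *m H *m A = A ->
    (A *m G)^T = A *m G -> (A *m H)^T = A *m H ->
  A *m G = A *m H.
Proof.
move=> AGA AHA AG_sym AH_sym.
by rewrite -AG_sym -{1}AHA -(mulmxA (A *m H)) trmx_mul AG_sym AH_sym mulmxA AGA.
Qed.

Section Uniqueness.
Variables (R : realType) (n : nat).
Implicit Types A G H : 'M[dual R]_n.

Lemma dual_group_inverse_unique A G H :
  is_dual_group_inverse A G -> is_dual_group_inverse A H -> G = H.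
Proof.
move=> [AGA GAG AG] [AHA HAH AH].
(* By commutation, A G = (A H)(A G) = (H A)(G A) = H A = A H. *)
have AGH : A *m G = A *m H.
  by rewrite -{1}AHA -(mulmxA (A *m H)) AH AG -!mulmxA (mulmxA A G) AGA.
by rewrite -GAG -AG AGH AH -mulmxA AGH mulmxA HAH.
Qed.

Lemma dual_MP_inverse_unique A G H :
  is_dual_MP_inverse A G -> is_dual_MP_inverse A H -> G = H.
Proof.
move=> [AGA GAG AG GA] [AHA HAH AH HA].
have AGH := symmetric_projector_eq _ _ _ _ _ AGA AHA AG AH.
(* Mirror image of the projector argument, on the other side: H A = (H A G A)^T = G A H A = G A. *)
have GAH : G *m A = H *m A.
  by rewrite -HA -{2}AGA -mulmxA mulmxA trmx_mul HA GA -!mulmxA (mulmxA A H) AHA.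
by rewrite -GAG GAH -mulmxA AGH mulmxA HAH.
Qed.

(** A core inverse K is recovered from A K, since Y A K = Y A A K^2 = A K^2 = K, and the projector A
    K is the same for both inverses. *)
Lemma dual_core_inverse_unique A Y G H : Y *m A *m A = A ->
  is_dual_core_inverse A G -> is_dual_core_inverse A H -> G = H.
Proof.
move=> YAA [AGA AGG AG] [AHA AHH AH].
have core_absorb K : A *m (K *m K) = K -> Y *m (A *m K) = K.
  by move=> AKK; rewrite -{1}AKK !mulmxA YAA -mulmxA.
rewrite -(core_absorb G AGG) -(core_absorb H AHH).
by rewrite (symmetric_projector_eq _ _ _ _ _ AGA AHA AG AH).
Qed.

End Uniqueness.

Theorem theorem3p15 (R : realType) (n : nat) (A : 'M[dual R]_n)
    (A_sym : A^T = A) (A_index1 : dual_index_one A) :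
  exists G : 'M[dual R]_n,
    [/\ unique (is_dual_group_inverse A) G,
        unique (is_dual_MP_inverse A) G
      & unique (is_dual_core_inverse A) G].
Proof.
have [|X AX] := @dual_range_subset_factor R n A (A *m A).
  by rewrite A_index1.
have [G_sym AG AGA GAG] := symmetric_factor_group_inverse _ _ _ _ A_sym AX.
set G := X^T *m A *m X in G_sym AG AGA GAG.
have AG_sym : (A *m G)^T = A *m G by rewrite trmx_mul G_sym A_sym.
have group_G : is_dual_group_inverse A G by [].
have MP_G : is_dual_MP_inverse A G by split; rewrite // -AG.
have core_G : is_dual_core_inverse A G by split; rewrite // mulmxA AG.
exists G; split; split=> // H.
- exact: dual_group_inverse_unique.
- exact: dual_MP_inverse_unique.
(* Here [G] itself serves as [Y]: by commutation G A A = A G A = A. *)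
- by apply: (@dual_core_inverse_unique _ _ _ G) => //; rewrite -AG.
Qed.
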